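(* Let $T$ be a finite tree and let $e$ be an edge of $T$ that does not lie on a pendant path. Let $T^{*}$ be the tree obtained from $T$ by contracting $e$. Then $$\mu_{T}-\mu_{T^{*}}>\frac{1}{3}.$$
   Context: All trees are finite. A subtree of a tree $T$ is a nonempty connected subgraph of $T$ (single vertices and $T$ itself are included); its order is its number of vertices. The mean subtree order (global mean) $\mu_T$ is the average order of all subtrees of $T$. An edge $e$ of $T$ lies on a pendant path if one end $u$ of $e$ connects to some leaf, away from $e$, through only vertices of degree two; that is, one of the two components of $T-e$ is a path (possibly a single vertex) having the end $u$ of $e$ as one of its end vertices. In particular every pendant edge (edge incident to a leaf) lies on a pendant path. Contracting an edge means deleting it and identifying its two ends, so $T^*$ is a tree with one vertex fewer than $T$. *)

(* Defs.v *)
From HB Require Import structures.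
From mathcomp Require Import all_boot all_order all_algebra.

Set Implicit Arguments.
Unset Strict Implicit.
Unset Printing Implicit Defensive.

Import Order.TTheory GRing.Theory Num.Theory.

Local Open Scope ring_scope.

Record sgraph := SGraph {
  vertex :> finType;
  adj : rel vertex;
  adj_sym : symmetric adj;
  adj_irrefl : irreflexive adj }.

Definition connected (G : sgraph) : Prop := forall x y : G, connect (@adj G) x y.

Definition acyclic (G : sgraph) : Prop :=
  forall c : seq G, (2 < size c)%N -> ~ ucycle (@adj G) c.

Definition is_tree (G : sgraph) : Prop :=
  [/\ (0 < #|G|)%N, connected G & acyclic G].

Definition edges (G : sgraph) : {set {set G}} :=
  [set [set xy.1; xy.2] | xy in [set xy : G * G | adj xy.1 xy.2]].

(* A candidate subgraph is a pair (W, F) of a vertex set and an edge set; F may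
   be any set of edges of G with both ends in W, not only the induced one. *)
Definition is_subgraph (G : sgraph) (H : {set G} * {set {set G}}) : bool :=
  (H.2 \subset edges G) && [forall f in H.2, f \subset H.1].

Definition is_subtree (G : sgraph) (H : {set G} * {set {set G}}) : bool :=
  [&& is_subgraph H, H.1 != set0 &
      [forall x in H.1, forall y in H.1,
         connect (fun a b => [set a; b] \in H.2) x y]].

Definition subtrees (G : sgraph) : {set {set G} * {set {set G}}} :=
  [set H | is_subtree H].

Definition mean_subtree_order (G : sgraph) : rat :=
  (\sum_(H in subtrees G) #|H.1|)%N%:R / #|subtrees G|%:R.

Section EdgeOperations.
Variables (G : sgraph) (u v : G).

Definition delete_adj : rel G :=
  fun x y => adj x y && ([set x; y] != [set u; v]).

Lemma delete_adj_sym : symmetric delete_adj.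
Proof. by move=> x y; rewrite /delete_adj adj_sym setUC. Qed.

Lemma delete_adj_irrefl : irreflexive delete_adj.
Proof. by move=> x; rewrite /delete_adj adj_irrefl. Qed.

Definition delete_edge : sgraph := SGraph delete_adj_sym delete_adj_irrefl.

(* v is merged into u, so the vertices of the contraction are those of G other
   than v, and u stands for the merged vertex. *)
Definition merge (x : G) : G := if x == v then u else x.

Definition contract_adj : rel {x : G | x != v} :=
  fun x y => (x != y) &&
    [exists a, exists b, [&& merge a == val x, merge b == val y & adj a b]].

Lemma contract_adj_sym : symmetric contract_adj.
Proof.
suff imp x y : contract_adj x y -> contract_adj y x.
  by move=> x y; apply/idP/idP; apply: imp.
case/andP=> xy /existsP[a /existsP[b /and3P[ax bY ab]]].
rewrite /contract_adj eq_sym xy; apply/existsP; exists b; apply/existsP; exists a.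
by rewrite ax bY adj_sym.
Qed.

Lemma contract_adj_irrefl : irreflexive contract_adj.
Proof. by move=> x; rewrite /contract_adj eqxx. Qed.

Definition contract_edge : sgraph := SGraph contract_adj_sym contract_adj_irrefl.

End EdgeOperations.

Definition component (G : sgraph) (x : G) : {set G} :=
  [set y | connect (@adj G) x y].

(* The component of u is a path graph whose vertices in order are u :: s. *)
Definition component_is_path_from (G : sgraph) (u : G) : Prop :=
  exists s : seq G,
    [/\ uniq (u :: s), u :: s =i component u &
        forall i j, (i < size (u :: s))%N -> (j < size (u :: s))%N ->
          adj (nth u (u :: s) i) (nth u (u :: s) j)
            = (i.+1 == j) || (j.+1 == i)].

Definition on_pendant_path (G : sgraph) (u v : G) : Prop :=
  @component_is_path_from (delete_edge u v) u \/
  @component_is_path_from (delete_edge u v) v.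

(* Main.v *)
Require Import Defs.
From mathcomp Require Import all_boot all_order all_algebra.
From mathcomp Require Import ring lra.

Set Implicit Arguments.
Unset Strict Implicit.
Unset Printing Implicit Defensive.

Import Order.TTheory GRing.Theory Num.Theory.

Local Open Scope ring_scope.

(** Delete the edge uv and let A, B be the two sides, rooted at u and v.  Let
a and a' be the number and the total order of the subtrees of A containing u,
p and p' those of the subtrees of A avoiding u, and define b, b', q, q' in the
same way for B and v.  A subtree of T lies in A, or lies in B, or contains uv
and is then a pair of subtrees containing u and v.  A subtree of the
contraction is a subtree of T that contains both or none of u and v, counted
with one vertex less in the first case.  Hence both means are explicit rational
functions of the eight numbers, and the claim is an inequality D > 0, where

  D = (a' + b' + ab) N - M (a + b) - N (N + a + b) / 3,
  N = p + q + ab,   M = p' + q' + a'b + ab' - ab.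

Three inequalities hold for every rooted tree:

  2 p <= a (a - 1),
  e := a^2 + 2a + p - 3a' >= 0,
  d := 3 (a'p - ap') - p (p + a) >= 0,

all three being equalities when the tree is a path starting at its root, while
e > 0 for any other rooted tree.  The last one says that removing the root
decreases the mean by at least 1/3.  With e1, d1 for A and e2, d2 for B,

  3ab D = (a + b)(b d1 + a d2) + b e1 (bp + a (b^2 - q)) + a e2 (aq + b (a^2 - p)),

where the factors of e1 and e2 are positive by the first inequality
([mean_contraction]).  As A is not a path starting at u, e1 > 0 and so D > 0.

The three inequalities are proved by induction ([stats_bounds]).  Cutting an
edge rc at the root r splits a rooted tree into a smaller tree at r and a tree
at c.  The latter, extended by the edge rc, is glued to the former at r.
[rooted_bounds_extend] and [rooted_bounds_merge] treat these two operations.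

Subtrees are pairs of a vertex set and an edge set.  In a tree every edge is a
bridge, so the edge set is determined by the vertex set, and the counting is
done with connected vertex sets.  The bridge property, unlike the absence of
cycles, passes to the contraction at once by lifting walks. *)

(** * Inequalities for rooted trees *)

(** The intended values are the number [a] and total order [a'] of the subtrees
containing the root, and the number [p] and total order [p'] of those avoiding
it.  The gap between 1 and 2 records that [a] is an integer; it is what makes
the product of two trees glued at the root satisfy [rb_mean]. *)
Record rooted_bounds (R : realFieldType) (a a' p p' : R) : Prop := RootedBounds {
  rb_gap : a = 1 \/ 2 <= a;
  rb_order : a <= a';
  rb_avoid_ge0 : 0 <= p;
  rb_avoid : 2 * p <= a * (a - 1);
  rb_local : 3 * a' <= a ^+ 2 + 2 * a + p;
  rb_mean : p * (p + a) <= 3 * (a' * p - a * p') }.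

Section Bounds.
Variable R : realFieldType.
Implicit Types a b p q x y : R.

Lemma rb_ge1 a a' p p' : rooted_bounds a a' p p' -> 1 <= a.
Proof. by move=> H; case: (rb_gap H) => [->//|]; lra. Qed.

Lemma rooted_bounds_single : rooted_bounds (1 : R) 1 0 0.
Proof. by split; [left| | | | |]; rewrite ?expr2; lra. Qed.

(** Hanging a rooted tree below a new root: a subtree containing the new root is
the root alone or the root joined to a subtree containing the old root. *)
Lemma rooted_bounds_extend b b' q q' : rooted_bounds b b' q q' ->
  rooted_bounds (1 + b) (1 + b + b') (b + q) (b' + q').
Proof.
move=> H; have b1 := rb_ge1 H; case: H => _ h1 h2 h3 h4 h5.
split; first by right; lra.
- by lra.
- by lra.
- by lra.
- by rewrite expr2 in h4 *; lra.
(* The mean order of all subtrees is at most (b + 2) / 3: bound q' by [rb_mean]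
   and then 3 b' - q by [rb_local]. *)
have h6 : 3 * (b' + q') <= (b + q) * (b + 2).
  have b0 : 0 < b by lra.
  rewrite -(ler_pM2l b0).
  have : 0 <= (b + q) * (b ^+ 2 + 2 * b + q - 3 * b') by rewrite mulr_ge0; lra.
  rewrite expr2 => h7; lra.
lra.
Qed.

(** How [rb_local] behaves when two trees are glued at their roots: the slacks
of the two trees add up, with weights, and there is an extra term that vanishes
only if one of the trees is reduced to its root.  This term is where the strict
inequality for branching trees comes from. *)
Lemma merge_local_slack a a' p p' b b' q q' :
  rooted_bounds a a' p p' -> rooted_bounds b b' q q' ->
  b * (a ^+ 2 + 2 * a + p - 3 * a') + a * (b ^+ 2 + 2 * b + q - 3 * b')
    + (a * (b - 1) + b * (a - 1)) * ((a - 1) * (b - 1)) / 2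
  <= (a * b) ^+ 2 + 2 * (a * b) + (p + q) - 3 * (a' * b + a * b' - a * b).
Proof.
move=> H K; have a1 := rb_ge1 H; have b1 := rb_ge1 K.
case: H => _ _ _ h3 _ _; case: K => _ _ _ k3 _ _.
have t3 : 0 <= (b - 1) * (a * (a - 1) - 2 * p) by rewrite mulr_ge0; lra.
have t4 : 0 <= (a - 1) * (b * (b - 1) - 2 * q) by rewrite mulr_ge0; lra.
rewrite !expr2; lra.
Qed.

(** Gluing two trees at their roots: a subtree containing the root is a pair of
such subtrees, which share one vertex. *)
Lemma rooted_bounds_merge a a' p p' b b' q q' :
  rooted_bounds a a' p p' -> rooted_bounds b b' q q' -> 2 <= b ->
  rooted_bounds (a * b) (a' * b + a * b' - a * b) (p + q) (p' + q').
Proof.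
move=> H K b2; have a1 := rb_ge1 H; have := merge_local_slack H K.
case: H => g1 h1 h2 h3 h4 h5; case: K => _ k1 k2 k3 k4 k5 slack.
have ab : 0 <= (a - 1) * (b - 1) by rewrite mulr_ge0; lra.
have aab : 0 <= a * ((a - 1) * (b - 1)) by rewrite mulr_ge0; lra.
have bab : 0 <= b * ((a - 1) * (b - 1)) by rewrite mulr_ge0; lra.
have aabb : 0 <= (a * b - 1) * ((a - 1) * (b - 1)) by rewrite mulr_ge0; lra.
split.
- by right; lra.
- have : 0 <= b * (a' - a) by rewrite mulr_ge0; lra.
  have : 0 <= a * (b' - b) by rewrite mulr_ge0; lra.
  lra.
- lra.
- lra.
- have t1 : 0 <= b * (a ^+ 2 + 2 * a + p - 3 * a') by rewrite mulr_ge0; lra.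
  have t2 : 0 <= a * (b ^+ 2 + 2 * b + q - 3 * b') by rewrite mulr_ge0; lra.
  have t3 : 0 <= (a * (b - 1) + b * (a - 1)) * ((a - 1) * (b - 1)).
    by rewrite mulr_ge0 // addr_ge0 // mulr_ge0; lra.
  lra.
have t1 : 0 <= b * (3 * (a' * p - a * p') - p * (p + a)).
  by rewrite mulr_ge0; lra.
have t2 : 0 <= a * (3 * (b' * q - b * q') - q * (q + b)).
  by rewrite mulr_ge0; lra.
have t3 : 0 <= p * (a * (b' - b)) by rewrite !mulr_ge0; lra.
have t4 : 0 <= q * (b * (a' - a)) by rewrite !mulr_ge0; lra.
(* Given a, b >= 2 this is the inequality of arithmetic and geometric means;
   otherwise a = 1 and then p = 0. *)
have t5 : 2 * p * q <= (b - 1) * p ^+ 2 + (a - 1) * q ^+ 2.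
  case: g1 => [a_eq|a2].
    have -> : p = 0 by move: h3; rewrite a_eq; lra.
    by rewrite a_eq expr2; lra.
  have := sqr_ge0 (p - q).
  have : 0 <= (b - 2) * p ^+ 2 by rewrite mulr_ge0 ?sqr_ge0; lra.
  have : 0 <= (a - 2) * q ^+ 2 by rewrite mulr_ge0 ?sqr_ge0; lra.
  rewrite !expr2; lra.
rewrite !expr2 in t5; lra.
Qed.

(** A rooted tree with equality in [rb_local] has at most one branch at the root,
and equality holds in that branch; by induction it is a path. *)
Lemma merge_local_lt a a' p p' b b' q q' :
  rooted_bounds a a' p p' -> rooted_bounds b b' q q' -> 2 <= b ->
  2 <= a \/ 3 * b' < b ^+ 2 + 2 * b + q ->
  3 * (a' * b + a * b' - a * b) < (a * b) ^+ 2 + 2 * (a * b) + (p + q).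
Proof.
move=> H K b2 str; have a1 := rb_ge1 H; have := merge_local_slack H K.
case: H => _ _ _ _ h4 _; case: K => _ _ _ _ k4 _ slack.
have t1 : 0 <= b * (a ^+ 2 + 2 * a + p - 3 * a') by rewrite mulr_ge0; lra.
case: str => [a2|lt].
  have t2 : 0 <= a * (b ^+ 2 + 2 * b + q - 3 * b') by rewrite mulr_ge0; lra.
  have : 0 < (a * (b - 1) + b * (a - 1)) * ((a - 1) * (b - 1)).
    by rewrite mulr_gt0 ?addr_gt0 ?mulr_gt0; lra.
  lra.
have t2 : 0 < a * (b ^+ 2 + 2 * b + q - 3 * b') by rewrite mulr_gt0; lra.
have : 0 <= (a * (b - 1) + b * (a - 1)) * ((a - 1) * (b - 1)).
  by rewrite mulr_ge0 ?addr_ge0 ?mulr_ge0; lra.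
lra.
Qed.

(** The two quotients are the mean subtree orders before and after contracting
the edge between the roots of two rooted trees. *)
Lemma mean_contraction a a' p p' b b' q q' :
  rooted_bounds a a' p p' -> rooted_bounds b b' q q' ->
  3 * a' < a ^+ 2 + 2 * a + p ->
  (a' + p' + (b' + q') + (a' * b + a * b')) / (a + p + (b + q) + a * b)
  - (p' + q' + (a' * b + a * b' - a * b)) / (p + q + a * b) > 1 / 3.
Proof.
move=> H K lt; have a1 := rb_ge1 H; have b1 := rb_ge1 K.
case: H => _ h1 h2 h3 h4 h5; case: K => _ k1 k2 k3 k4 k5.
have ab0 : 0 < a * b by rewrite mulr_gt0; lra.
set N := p + q + a * b; set M := p' + q' + (a' * b + a * b' - a * b).
have N0 : 0 < N by rewrite /N; lra.
have -> : a + p + (b + q) + a * b = N + (a + b) by rewrite /N; ring.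
have -> : a' + p' + (b' + q') + (a' * b + a * b') = M + (a' + b' + a * b).
  by rewrite /M; ring.
have Nab0 : 0 < N + (a + b) by lra.
pose D := (a' + b' + a * b) * N - M * (a + b) - N * (N + (a + b)) / 3.
have key : 0 < D.
  (* The inequality 2 q <= b (b - 1) gives q < b ^ 2, and likewise for p. *)
  have c1 : 0 < b * p + a * (b * b - q).
    by apply: ltr_wpDl; [rewrite mulr_ge0; lra|rewrite mulr_gt0; nra].
  have c2 : 0 <= a * q + b * (a * a - p).
    by apply: addr_ge0; rewrite mulr_ge0 //; try lra; nra.
  have id : 3 * (a * b) * D =
    (a + b) * (b * (3 * (a' * p - a * p') - p * (p + a))
               + a * (3 * (b' * q - b * q') - q * (q + b)))
    + (b * p + a * (b * b - q)) * (b * (a ^+ 2 + 2 * a + p - 3 * a'))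
    + (a * q + b * (a * a - p)) * (a * (b ^+ 2 + 2 * b + q - 3 * b')).
    by rewrite /D /N /M; field.
  have ab3 : 0 < 3 * (a * b) by lra.
  rewrite -(pmulr_rgt0 _ ab3) id.
  apply: ltr_wpDr; first by rewrite !mulr_ge0 //; lra.
  apply: ltr_wpDl.
    by rewrite mulr_ge0 //; [lra|rewrite addr_ge0 // mulr_ge0 //; lra].
  by rewrite !mulr_gt0 //; lra.
rewrite -subr_gt0.
have -> : (M + (a' + b' + a * b)) / (N + (a + b)) - M / N - 1 / 3 =
  D / (N * (N + (a + b))) by rewrite /D; field; rewrite !gt_eqF.
by rewrite divr_gt0 // mulr_gt0.
Qed.
End Bounds.

(** * Bridges and connected vertex sets *)

Lemma connect_hom (T T' : finType) (e : rel T) (e' : rel T') (f : T -> T') :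
  (forall x y, e x y -> connect e' (f x) (f y)) ->
  forall x y, connect e x y -> connect e' (f x) (f y).
Proof.
move=> ef x y /connectP[p]; elim: p x => [|z p IH] x /=.
  by move=> _ ->; apply: connect0.
by case/andP=> /ef xz /IH{}IH /IH; apply: connect_trans.
Qed.

Lemma set2_inj (T : finType) (a b x y : T) :
  [set a; b] = [set x; y] -> (a = x /\ b = y) \/ (a = y /\ b = x).
Proof.
move=> E; have := set21 a b; have := set22 a b; rewrite E !inE.
have := set21 x y; have := set22 x y; rewrite -E !inE.
by do 4![case/orP=> /eqP ?]; subst; auto.
Qed.

Section Connected.
Variable G : sgraph.
Implicit Types (S W : {set G}) (x y r c : G).

Definition bridged : Prop :=
  forall x y, adj x y -> ~~ connect (delete_adj x y) x y.

(** A path joining the ends of an edge without using it closes up to a cycle. *)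
Lemma acyclic_bridged : acyclic G -> bridged.
Proof.
move=> acyc x y xy; apply/negP => /connectP[p0 p0P y_last].
case/shortenP: p0P y_last => p pP p_uniq _ y_last.
have size_p : (2 < size (x :: p))%N.
  case: p pP y_last {p_uniq} => [|z [|t p]] //=.
    by move=> _ yx; rewrite yx adj_irrefl in xy.
  by rewrite /delete_adj andbT => + yz; rewrite yz eqxx andbF.
apply: (acyc _ size_p); rewrite /ucycle p_uniq andbT.
rewrite /cycle rcons_path -y_last adj_sym xy andbT.
by apply: sub_path pP => a b /andP[].
Qed.

Definition induced W : rel G := fun x y => [&& x \in W, y \in W & adj x y].

Definition conn W :=
  (W != set0) && [forall x in W, forall y in W, connect (induced W) x y].

Lemma induced_connect_sym W : connect_sym (induced W).
Proof.
by apply: sym_connect_sym => x y; rewrite /induced adj_sym andbCA.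
Qed.

Lemma conn_connect W x y :
  conn W -> x \in W -> y \in W -> connect (induced W) x y.
Proof. by case/andP=> _ /forall_inP cW /cW/forall_inP; apply. Qed.

Lemma connI W r :
  r \in W -> (forall x, x \in W -> connect (induced W) r x) -> conn W.
Proof.
move=> rW cW; apply/andP; split; first by apply/set0Pn; exists r.
apply/forall_inP=> x xW; apply/forall_inP=> y yW.
by apply: connect_trans (cW y yW); rewrite induced_connect_sym cW.
Qed.

Lemma sub_induced_connect W S x y :
  W \subset S -> connect (induced W) x y -> connect (induced S) x y.
Proof.
move/subsetP=> sWS; apply: connect_sub => a b /and3P[aW bW ab].
by apply: connect1; rewrite /induced !sWS.
Qed.

Lemma conn1 r : conn [set r].
Proof. by apply: (@connI _ r); rewrite ?set11 // => x /set1P ->. Qed.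

(** * Cutting a connected set along a bridge *)

Record cut (A B : {set G}) (r c : G) : Prop := Cut {
  cut_disjoint : [disjoint A & B];
  cut_l : r \in A;
  cut_r : c \in B;
  cut_adj : adj r c;
  cut_only : forall x y, x \in A -> y \in B -> adj x y -> x = r /\ y = c }.

Lemma cut_sym A B r c : cut A B r c -> cut B A c r.
Proof.
case=> dAB rA cB rc only; split=> //; first by rewrite disjoint_sym.
  by rewrite adj_sym.
by move=> x y xB yA xy; have [|-> ->] := only y x yA xB; rewrite 1?adj_sym.
Qed.

(** A connected set that meets both sides must use the only edge between them:
otherwise its trace on one side is closed under adjacency. *)
Lemma cut_side A B r c W :
  cut A B r c -> conn W -> W \subset A :|: B -> ~~ ((r \in W) && (c \in W)) ->
  (W \subset A) || (W \subset B).
Proof.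
move=> cAB cW /subsetP sW nrc.
have clA : closed (induced W) (mem A).
  apply: (intro_closed (induced_connect_sym W)) => x y /and3P[xW yW xy] xA.
  have /setUP[//|yB] := sW y yW.
  have [xr yc] := cut_only cAB xA yB xy.
  by rewrite -xr -yc xW yW in nrc.
case/andP: (cW) => /set0Pn[w wW] _.
have memA x : x \in W -> (x \in A) = (w \in A).
  by move=> xW; rewrite (closed_connect clA (conn_connect cW xW wW)).
have [wA|wA] := boolP (w \in A); apply/orP; [left|right]; apply/subsetP => x xW.
  by rewrite memA.
by have /setUP[|//] := sW x xW; rewrite memA // (negPf wA).
Qed.

(** Retracting the far side to the root [r] maps walks to walks, because the
far side is attached to [r] only. *)
Lemma conn_cutI A B r c W :
  cut A B r c -> conn W -> W \subset A :|: B -> r \in W -> conn (W :&: A).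
Proof.
move=> cAB cW /subsetP sW rW; have rA := cut_l cAB.
apply: (@connI _ r) => [|x /setIP[xW xA]]; first by rewrite inE rW.
have := conn_connect cW rW xW.
pose f z := if z \in A then z else r.
have fA z : z \in A -> f z = z by rewrite /f => ->.
rewrite -{2}(fA r) // -{2}(fA x) //; apply: connect_hom => a b.
case/and3P=> aW bW ab; rewrite /f.
have inB z : z \in W -> z \notin A -> z \in B.
  by move=> /sW/setUP[->|].
have [aA|/(inB _ aW) aB] := boolP (a \in A);
  have [bA|/(inB _ bW) bB] := boolP (b \in A) => //.
- by apply: connect1; rewrite /induced !inE aW bW aA bA ab.
- by have [-> _] := cut_only cAB aA bB ab.
- by rewrite adj_sym in ab; have [-> _] := cut_only cAB bA aB ab.
Qed.

Lemma conn_cutU A B r c W1 W2 :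
  cut A B r c -> conn W1 -> conn W2 -> r \in W1 -> c \in W2 ->
  conn (W1 :|: W2).
Proof.
move=> cAB c1 c2 r1 c2'; apply: (@connI _ r) => [|x]; first by rewrite inE r1.
case/setUP=> [x1|x2].
  exact: sub_induced_connect (subsetUl _ _) (conn_connect c1 r1 x1).
apply: (@connect_trans _ _ c).
  by apply: connect1; rewrite /induced !inE r1 c2' (cut_adj cAB) orbT.
exact: sub_induced_connect (subsetUr _ _) (conn_connect c2 c2' x2).
Qed.

Lemma comp_conn (e : rel G) r :
  subrel e (@adj G) -> conn [set x | connect e r x].
Proof.
move=> e_adj; set S := [set x | _].
have walk p x : connect e r x -> path e x p -> connect (induced S) x (last x p).
  elim: p x => [|y p IH] x /= rx; first by rewrite connect0.
  case/andP=> xy yp; have ry := connect_trans rx (connect1 xy).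
  apply: connect_trans (IH y ry yp); apply: connect1.
  by rewrite /induced !inE rx ry e_adj.
apply: (@connI _ r) => [|x]; first by rewrite inE.
by rewrite inE => /connectP[p pP ->]; apply: walk.
Qed.

(** In a graph whose edges are bridges, deleting the edge [rc] leaves exactly two
connected parts, and no other edge joins them. *)
Lemma split_cut S r c : bridged -> conn S -> r \in S -> c \in S -> adj r c ->
  let e x y := [&& x \in S, y \in S & delete_adj r c x y] in
  let A := [set x | connect e r x] in let B := [set x | connect e c x] in
  [/\ cut A B r c, conn A, conn B & S = A :|: B].
Proof.
move=> br cS rS cS' rc e A B.
have e_adj : subrel e (@adj G) by move=> x y /and3P[_ _ /andP[]].
have e_sym : connect_sym e.
  by apply: sym_connect_sym => x y; rewrite /e delete_adj_sym andbCA.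
have e_del x y : connect e x y -> connect (delete_adj r c) x y.
  by apply: connect_sub => a b /and3P[_ _ ab]; apply: connect1.
have rc_sep : ~~ connect e r c by apply: contra (br _ _ rc) => /e_del.
have e_in r0 x : r0 \in S -> connect e r0 x -> x \in S.
  move=> r0S /connectP[p]; elim/last_ind: p x => [|p y _] x /=; first by move=> _ ->.
  by rewrite rcons_path last_rcons => /andP[_ /and3P[_ yS _]] ->.
split; [split|exact: comp_conn|exact: comp_conn|] => //.
- apply/pred0P => x /=; apply/negP => /andP[]; rewrite !inE => rx cx.
  by case/negP: rc_sep; apply: connect_trans rx _; rewrite e_sym.
- by rewrite inE.
- by rewrite inE.
- move=> x y; rewrite !inE => rx cy xy.
  have xS := e_in _ _ rS rx; have yS := e_in _ _ cS' cy.
  have [E|ne] := eqVneq [set x; y] [set r; c].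
    case: (set2_inj E) => -[? ?]; subst=> //.
    by rewrite rx in rc_sep.
  have xy1 : connect e x y by apply: connect1; rewrite /e xS yS /delete_adj xy.
  rewrite e_sym in cy; case/negP: rc_sep.
  exact: connect_trans (connect_trans rx xy1) cy.
- apply/setP=> x; apply/idP/idP => [xS|]; last first.
    by rewrite !inE => /orP[]; apply: e_in.
  have cl : closed (induced S) (mem (A :|: B)).
    apply: (intro_closed (induced_connect_sym S)) => a b /and3P[aS bS ab].
    have [E _|ne] := eqVneq [set a; b] [set r; c].
      by have := set22 a b; rewrite E !inE => /orP[] /eqP ->; rewrite connect0 ?orbT.
    have eab : connect e a b by apply: connect1; rewrite /e aS bS /delete_adj ab.
    by rewrite !inE => /orP[] H; rewrite (connect_trans H eab) ?orbT.
  have := closed_connect cl (conn_connect cS rS xS).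
  by rewrite !inE connect0 /= => <-.
Qed.

(** Induction on rooted trees, seen as connected sets with a marked element: any
edge at the root can be cut. *)
Lemma rooted_ind (P : {set G} -> G -> Prop) : bridged ->
  (forall r, P [set r] r) ->
  (forall A B r c, cut A B r c -> conn A -> conn B -> P A r -> P B c ->
     P (A :|: B) r) ->
  forall S r, conn S -> r \in S -> P S r.
Proof.
move=> br P1 Pcut S; have [n] := ubnP #|S|; elim: n S => // n IH S.
rewrite ltnS => leSn r cS rS.
have [->|ne] := eqVneq S [set r]; first exact: P1.
have [c cS' rc] : exists2 c, c \in S & adj r c.
  have [x xS xr] : exists2 x, x \in S & x != r.
    apply/exists_inP; apply: contraR ne => /exists_inPn no.
    rewrite eqEsubset sub1set rS andbT; apply/subsetP => x /no.
    by rewrite negbK inE.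
  have /connectP[[|c p] /=] := conn_connect cS rS xS.
    by move=> _ xr'; rewrite xr' eqxx in xr.
  by case/andP=> /and3P[_ cS' rc] _ _; exists c.
have [] := split_cut br cS rS cS' rc; set A := finset _; set B := finset _.
move=> cAB cA cB SE; rewrite SE in leSn *.
have cAB0 := disjoint_setI0 (cut_disjoint cAB).
have cardU : #|A :|: B| = (#|A| + #|B|)%N by rewrite cardsU cAB0 cards0 subn0.
have A0 : (0 < #|A|)%N by rewrite card_gt0; case/andP: cA.
have B0 : (0 < #|B|)%N by rewrite card_gt0; case/andP: cB.
apply: (Pcut _ _ _ _ cAB cA cB); apply: IH => //.
- by apply: leq_trans leSn; rewrite cardU -addn1 leq_add2l.
- exact: cut_l cAB.
- by apply: leq_trans leSn; rewrite cardU -add1n leq_add2r.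
- exact: cut_r cAB.
Qed.

End Connected.

(** * Counting connected sets across a cut *)

Section Counting.
Variable G : sgraph.
Implicit Types (S W A B : {set G}) (x y r c : G) (F : {set {set G}}).

Definition rooted S r := [set W | [&& conn W, W \subset S & r \in W]].
Definition avoiding S r := [set W | [&& conn W, W \subset S & r \notin W]].
Definition total_order F := (\sum_(W in F) #|W|)%N.

Section Cut.
Variables (A B : {set G}) (r c : G).
Hypothesis cutAB : cut A B r c.

Let rB : r \notin B.
Proof. by rewrite (disjointFr (cut_disjoint cutAB) (cut_l cutAB)). Qed.
Let cA : c \notin A.
Proof. by rewrite (disjointFl (cut_disjoint cutAB) (cut_r cutAB)). Qed.

(** The connected sets that use the cut edge are in bijection with the pairs of
their traces on the two sides.  An arbitrary weight [f] serves for the number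
and for the total order at once. *)
Lemma sum_joining (f : {set G} -> nat) :
  (\sum_(W | [&& conn W, W \subset A :|: B & (r \in W) && (c \in W)]) f W =
   \sum_(W1 in rooted A r) \sum_(W2 in rooted B c) f (W1 :|: W2))%N.
Proof.
rewrite pair_big /=.
rewrite (reindex_onto (fun p : {set G} * {set G} => p.1 :|: p.2)
           (fun W => (W :&: A, W :&: B))) /=; last first.
  by move=> W /and3P[_ sW _]; rewrite -setIUr; apply/setIidPl.
apply: eq_bigl => -[W1 W2] /=; rewrite !inE xpair_eqE.
have AB0 := disjoint_setI0 (cut_disjoint cutAB).
apply/idP/idP.
  case/andP=> /and3P[cW sW /andP[rW cW']] /andP[/eqP E1 /eqP E2].
  have rA := cut_l cutAB; have cB := cut_r cutAB.
  have sW' : W1 :|: W2 \subset B :|: A by rewrite [B :|: A]setUC.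
  have := conn_cutI cutAB cW sW; rewrite inE E1 => /(_ rW) c1.
  have := conn_cutI (cut_sym cutAB) cW sW'; rewrite inE E2 => /(_ cW') c2.
  have s1 : W1 \subset A by rewrite -E1 subsetIr.
  have s2 : W2 \subset B by rewrite -E2 subsetIr.
  have r1 : r \in W1 by rewrite -E1 !inE rA rW.
  have c2' : c \in W2 by rewrite -E2 !inE cB cW'.
  by rewrite c1 c2 s1 s2 r1.
case/andP=> /and3P[c1 s1 r1] /and3P[c2 s2 c2'].
rewrite (conn_cutU cutAB) // setUSS // r1 c2' orbT /= !setIUl.
have -> : W1 :&: A = W1 by apply/setIidPl.
have -> : W2 :&: B = W2 by apply/setIidPl.
have -> : W2 :&: A = set0.
  by apply/eqP; rewrite -subset0 -AB0 setIC setIS.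
have -> : W1 :&: B = set0.
  by apply/eqP; rewrite -subset0 -AB0 setSI.
by rewrite setU0 set0U !eqxx.
Qed.

Lemma sum_rooted (f : {set G} -> nat) :
  (\sum_(W in rooted (A :|: B) r) f W =
   \sum_(W in rooted A r) f W +
   \sum_(W1 in rooted A r) \sum_(W2 in rooted B c) f (W1 :|: W2))%N.
Proof.
rewrite (bigID (fun W : {set G} => c \in W)) /= addnC -sum_joining.
congr (_ + _)%N; apply: eq_bigl => W; rewrite !inE; last by rewrite -!andbA.
apply/idP/idP => [/andP[/and3P[cW sW rW] cW']|/and3P[-> sW rW]].
  rewrite cW rW andbT /=.
  have := cut_side cutAB cW sW; rewrite (negPf cW') andbF => /(_ isT)/orP[//|].
  by move/subsetP/(_ _ rW); rewrite (negPf rB).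
rewrite rW subsetU ?sW //=; apply: contra cA; exact: (subsetP sW).
Qed.

Lemma sum_avoiding (f : {set G} -> nat) :
  (\sum_(W in avoiding (A :|: B) r) f W =
   \sum_(W in avoiding A r) f W +
   (\sum_(W in rooted B c) f W + \sum_(W in avoiding B c) f W))%N.
Proof.
rewrite (bigID (fun W : {set G} => W \subset A)) /=.
congr (_ + _)%N.
  apply: eq_bigl => W; rewrite !inE.
  apply/idP/idP => [/andP[/and3P[-> _ ->] ->] //|/and3P[-> sW ->]].
  by rewrite subsetU ?sW.
rewrite (bigID (fun W : {set G} => c \in W)) /=.
have E W : [&& conn W, W \subset A :|: B & r \notin W] && ~~ (W \subset A) =
           conn W && (W \subset B).
  apply/idP/idP => [/andP[/and3P[cW sW rW] nA]|/andP[cW sW]].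
    by have := cut_side cutAB cW sW; rewrite (negPf rW) (negPf nA) cW => /(_ isT) /= ->.
  rewrite cW subsetU ?sW ?orbT //=; apply/andP; split.
    apply: contra rB; exact: (subsetP sW).
  case/andP: (cW) => /set0Pn[x xW] _; apply/negP => /subsetP/(_ _ xW) xA.
  by have := disjointFr (cut_disjoint cutAB) xA; rewrite (subsetP sW).
by congr (_ + _)%N; apply: eq_bigl => W; rewrite !inE E -andbA.
Qed.

(** The sets that contain both or none of the ends of the cut edge are those
that remain connected sets when this edge is contracted. *)
Lemma sum_balanced (f : {set G} -> nat) :
  (\sum_(W | [&& conn W, W \subset A :|: B & (r \in W) == (c \in W)]) f W =
   \sum_(W1 in rooted A r) \sum_(W2 in rooted B c) f (W1 :|: W2) +
   (\sum_(W in avoiding A r) f W + \sum_(W in avoiding B c) f W))%N.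
Proof.
rewrite (bigID (fun W : {set G} => r \in W)) /= -sum_joining.
congr (_ + _)%N.
  apply: eq_bigl => W; rewrite -!andbA; do 2![congr (_ && _)].
  by case: (r \in W); rewrite ?andbF // andbT eq_sym eqb_id.
rewrite (bigID (fun W : {set G} => W \subset A)) /=.
congr (_ + _)%N; apply: eq_bigl => W; rewrite !inE.
  apply/idP/idP => [/andP[/andP[/and3P[-> _ _] ->] ->] //|/and3P[-> sW rW]].
  have cW : c \notin W by apply: contra cA; exact: (subsetP sW).
  by rewrite subsetU ?sW //= (negPf rW) (negPf cW).
apply/idP/idP => [/andP[/andP[/and3P[cW sW /eqP rc] rW] nA]|/and3P[cW sW cW']].
  rewrite cW -rc rW andbT.
  by have := cut_side cutAB cW sW; rewrite (negPf rW) (negPf nA) => /(_ isT) /= ->.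
have rW : r \notin W by apply: contra rB; exact: (subsetP sW).
rewrite cW subsetU ?sW ?orbT //= (negPf rW) (negPf cW') /=.
case/andP: (cW) => /set0Pn[x xW] _; apply/negP => /subsetP/(_ _ xW) xA.
by have := disjointFr (cut_disjoint cutAB) xA; rewrite (subsetP sW).
Qed.

Lemma sum_pairs_card :
  (\sum_(W1 in rooted A r) \sum_(W2 in rooted B c) #|W1 :|: W2| =
   total_order (rooted A r) * #|rooted B c| +
   #|rooted A r| * total_order (rooted B c))%N.
Proof.
rewrite mulnC /total_order big_distrr -sum_nat_const -big_split /=.
apply: eq_bigr => W1; rewrite inE => /and3P[_ s1 _].
rewrite -sum_nat_const -big_split /=.
apply: eq_bigr => W2; rewrite inE => /and3P[_ s2 _].
suff W120 : W1 :&: W2 = set0 by rewrite cardsU W120 cards0 subn0.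
apply/eqP; rewrite -subset0 -(disjoint_setI0 (cut_disjoint cutAB)).
exact: setISS.
Qed.

Lemma sum_pairs_1 :
  (\sum_(W1 in rooted A r) \sum_(W2 in rooted B c) 1 =
   #|rooted A r| * #|rooted B c|)%N.
Proof.
by rewrite -sum_nat_const; apply: eq_bigr => W1 _; rewrite sum1_card.
Qed.

Lemma card_rooted_cut :
  #|rooted (A :|: B) r| = (#|rooted A r| + #|rooted A r| * #|rooted B c|)%N.
Proof. by rewrite -sum1_card sum_rooted sum1_card sum_pairs_1. Qed.

Lemma card_avoiding_cut :
  #|avoiding (A :|: B) r| =
  (#|avoiding A r| + (#|rooted B c| + #|avoiding B c|))%N.
Proof. by rewrite -sum1_card sum_avoiding !sum1_card. Qed.

Lemma total_rooted_cut :
  total_order (rooted (A :|: B) r) =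
  (total_order (rooted A r) + (total_order (rooted A r) * #|rooted B c| +
     #|rooted A r| * total_order (rooted B c)))%N.
Proof. by rewrite /total_order sum_rooted sum_pairs_card. Qed.

Lemma total_avoiding_cut :
  total_order (avoiding (A :|: B) r) =
  (total_order (avoiding A r) +
     (total_order (rooted B c) + total_order (avoiding B c)))%N.
Proof. by rewrite /total_order sum_avoiding. Qed.

End Cut.

Lemma rooted1 r : rooted [set r] r = [set [set r]].
Proof.
apply/setP=> W; rewrite !inE; apply/and3P/eqP => [[_ sW rW]|->].
  by apply/eqP; rewrite eqEsubset sW sub1set.
by split; rewrite ?set11 ?conn1.
Qed.

Lemma avoiding1 r : avoiding [set r] r = set0.
Proof.
apply/setP=> W; rewrite !inE; apply/negP => /and3P[/andP[/set0Pn[x xW] _]].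
by move/subsetP/(_ _ xW)/set1P => <-; rewrite xW.
Qed.

Lemma card_rooted_gt1 S r :
  conn S -> r \in S -> S != [set r] -> (1 < #|rooted S r|)%N.
Proof.
move=> cS rS ne; apply/card_gt1P; exists S, [set r].
by rewrite !inE cS rS subxx conn1 sub1set rS eqxx.
Qed.

(** The set [S] induces a path starting at [r]; this is the form in which
pendant paths are described. *)
Definition path_from S r := exists s : seq G,
  [/\ uniq (r :: s), r :: s =i S &
      forall i j, (i < size (r :: s))%N -> (j < size (r :: s))%N ->
        adj (nth r (r :: s) i) (nth r (r :: s) j) = (i.+1 == j) || (j.+1 == i)].

Lemma path_from1 r : path_from [set r] r.
Proof.
exists [::]; split=> // [x|[|i] [|j] //= _ _]; first by rewrite !inE.
by rewrite adj_irrefl.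
Qed.

Lemma path_from_extend B r c :
  cut [set r] B r c -> path_from B c -> path_from ([set r] :|: B) r.
Proof.
move=> cutB [s [s_uniq sB s_adj]]; exists (c :: s).
have rB : r \notin B by rewrite (disjointFr (cut_disjoint cutB) (set11 r)).
have mem_nth_B k : (k < size (c :: s))%N -> nth r (c :: s) k \in B.
  by move=> lk; rewrite -sB mem_nth.
have adj_r k : (k < size (c :: s))%N -> adj r (nth r (c :: s) k) = (k == 0)%N.
  move=> lk; case: k lk => [|k] lk; first by rewrite (cut_adj cutB).
  apply/negP => rk; have [_ E] := cut_only cutB (set11 r) (mem_nth_B _ lk) rk.
  by have := nth_uniq r lk (ltn0Sn (size s)) s_uniq; rewrite E eqxx.
split.
- by rewrite /= -/(uniq (c :: s)) s_uniq sB rB.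
- by move=> x; rewrite in_setU in_set1 -sB inE.
move=> [|i] [|j]; rewrite ?ltnS => li lj.
- by rewrite /= adj_irrefl.
- by rewrite -[nth r _ 0]/r -[nth r _ j.+1]/(nth r (c :: s) j) adj_r // eq_sym orbF.
- by rewrite -[nth r _ 0]/r -[nth r _ i.+1]/(nth r (c :: s) i) adj_sym adj_r // eq_sym.
rewrite -[nth r _ i.+1]/(nth r (c :: s) i) -[nth r _ j.+1]/(nth r (c :: s) j).
by rewrite (set_nth_default c) // [X in adj _ X](set_nth_default c) // s_adj.
Qed.

Definition stats_bounded S r :=
  rooted_bounds (R := rat) #|rooted S r|%:R (total_order (rooted S r))%:R
    #|avoiding S r|%:R (total_order (avoiding S r))%:R.

Definition local_strict S r : Prop :=
  3 * (total_order (rooted S r))%:R <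
  #|rooted S r|%:R ^+ 2 + 2 * #|rooted S r|%:R + #|avoiding S r|%:R :> rat.

(** The decomposition at the root edge [rc] is an extension of the part at [c]
followed by gluing to the part at [r].  Equality in [rb_local] survives only if
the part at [r] is reduced to [r] and the part at [c] is a path, in which case
the union is a path again. *)
Lemma stats_bounds S r : bridged G -> conn S -> r \in S ->
  stats_bounded S r /\ (local_strict S r \/ path_from S r).
Proof.
move=> br; move: S r; apply: rooted_ind => // [r|A B r c cutAB cA cB [HA _] [HB sB]].
  split; last by right; apply: path_from1.
  rewrite /stats_bounded rooted1 avoiding1 /total_order big_set1 big_set0.
  by rewrite cards0 !cards1; apply: rooted_bounds_single.
have b1 := rb_ge1 HB; have HB' := rooted_bounds_extend HB.
have b2 : 2 <= 1 + #|rooted B c|%:R :> rat by lra.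
rewrite /stats_bounded /local_strict.
rewrite (card_rooted_cut cutAB) (card_avoiding_cut cutAB).
rewrite (total_rooted_cut cutAB) (total_avoiding_cut cutAB).
rewrite !(natrD, natrM).
set a := #|rooted A r|%:R in HA *; set b := #|rooted B c|%:R in HB HB' b1 b2 *.
set a' := (total_order (rooted A r))%:R in HA *.
set b' := (total_order (rooted B c))%:R in HB HB' *.
have -> : a + a * b = a * (1 + b) by ring.
have -> : a' + (a' * b + a * b') = a' * (1 + b) + a * (1 + b + b') - a * (1 + b).
  by ring.
split; first exact: (rooted_bounds_merge HA HB' b2).
have [A1|nA1] := eqVneq A [set r]; last first.
  left; apply: (merge_local_lt HA HB' b2); left.
  by rewrite /a (ler_nat _ 2) card_rooted_gt1 // (cut_l cutAB).
case: sB => [lt|pB]; [left|right].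
  apply: (merge_local_lt HA HB' b2); right.
  by rewrite /local_strict -/b -/b' in lt; rewrite !expr2 in lt *; lra.
by rewrite A1; apply: path_from_extend pB; rewrite -A1.
Qed.

End Counting.

(** * Subtrees as connected vertex sets *)

Section Subtrees.
Variable G : sgraph.

Lemma mem_edges (a b : G) : ([set a; b] \in edges G) = adj a b.
Proof.
apply/imsetP/idP => [[[x y]]|ab]; last by exists (a, b); rewrite ?inE.
by rewrite inE /= => xy /set2_inj[] [-> ->] //; rewrite adj_sym.
Qed.

(** If an edge between two vertices of a subtree were missing from it, the
subtree would join its ends without it, so it would not be a bridge. *)
Lemma subtree_conn (H : {set G} * {set {set G}}) : bridged G ->
  is_subtree H =
  conn H.1 && (H.2 == [set e in edges G | e \subset H.1]).
Proof.
move=> br; case: H => W F /=; rewrite /is_subtree /is_subgraph /conn /=.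
apply/idP/idP.
  case/and3P=> /andP[sFE /forall_inP sFW] W0 /forall_inP cW.
  have F_ind : subrel (fun a b => [set a; b] \in F) (induced W).
    move=> a b abF; have := sFW _ abF; rewrite subUset !sub1set => /andP[aW bW].
    by rewrite /induced aW bW -mem_edges (subsetP sFE).
  rewrite W0; apply/andP; split.
    apply/forall_inP=> x xW; apply/forall_inP=> y yW.
    have /forall_inP/(_ y yW) := cW x xW.
    by apply: connect_sub => a b /F_ind/connect1.
  rewrite eqEsubset; apply/andP; split; apply/subsetP => e.
    by move=> eF; rewrite inE (subsetP sFE) // sFW.
  rewrite inE => /andP[/imsetP[[a b]]]; rewrite inE /= => ab ->.
  rewrite subUset !sub1set => /andP[aW bW]; apply: contraT => nF.
  case/negP: (br _ _ ab); have /forall_inP/(_ b bW) := cW a aW.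
  apply: connect_sub => x y xyF; apply: connect1.
  have /and3P[_ _ xy] := F_ind _ _ xyF.
  by rewrite /delete_adj xy; apply: contra nF => /eqP <-.
case/andP=> /andP[W0 /forall_inP cW] /eqP ->; rewrite W0 /=; apply/andP; split.
  apply/andP; split; first by apply/subsetP => e; rewrite inE => /andP[].
  by apply/forall_inP=> e; rewrite inE => /andP[].
apply/forall_inP=> x xW; apply/forall_inP=> y yW.
have /forall_inP/(_ y yW) := cW x xW.
apply: connect_sub => a b /and3P[aW bW ab]; apply: connect1.
by rewrite inE mem_edges ab subUset !sub1set aW.
Qed.

Lemma sum_subtrees (f : {set G} -> nat) : bridged G ->
  (\sum_(H in subtrees G) f H.1 = \sum_(W | conn W) f W)%N.
Proof.
move=> br.
rewrite (reindex_onto (fun W : {set G} => (W, [set e in edges G | e \subset W])) fst) /=.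
  by apply: eq_bigl => W; rewrite inE subtree_conn //= !eqxx !andbT.
by case=> W F; rewrite inE subtree_conn // /= => /andP[_ /eqP ->].
Qed.

Lemma sum_rooted_avoiding (f : {set G} -> nat) r :
  (\sum_(W | conn W) f W =
   \sum_(W in rooted [set: G] r) f W + \sum_(W in avoiding [set: G] r) f W)%N.
Proof.
rewrite (bigID (fun W : {set G} => r \in W)) /=.
by congr (_ + _)%N; apply: eq_bigl => W; rewrite !inE subsetT.
Qed.

End Subtrees.

(** * Contraction of an edge *)

Section Contraction.
Variables (G : sgraph) (u v : G).
Hypothesis (uv : adj u v).

Let uNv : u != v. Proof. by apply: contraTneq uv => ->; rewrite adj_irrefl. Qed.
Notation G' := (contract_edge u v).
Let u' : G' := exist _ u uNv.
Let quo (x : G) : G' := insubd u' x.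

Let val_quo x : val (quo x) = Defs.merge u v x.
Proof. by rewrite val_insubd /Defs.merge; case: eqVneq. Qed.

Let quo_val (x : G') : quo (val x) = x.
Proof. exact: valKd. Qed.

Let quo_adj a b : adj a b -> quo a != quo b -> @adj G' (quo a) (quo b).
Proof.
move=> ab ne; rewrite /= /contract_adj ne /=.
by apply/existsP; exists a; apply/existsP; exists b; rewrite -!val_quo !eqxx.
Qed.

Let adj_quo (x y : G') : @adj G' x y ->
  x != y /\ exists a b, [/\ quo a = x, quo b = y & adj a b].
Proof.
case/andP=> ne /existsP[a /existsP[b /and3P[/eqP ax /eqP bY ab]]].
split=> //; exists a, b; split=> //; apply: val_inj; by rewrite val_quo.
Qed.

Let connect_merge (e : rel G) x :
  connect_sym e -> connect e u v -> connect e x (val (quo x)).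
Proof.
move=> e_sym e_uv; rewrite val_quo /Defs.merge; case: eqP => [->|_].
  by rewrite e_sym.
exact: connect0.
Qed.

Let set2_map (T T' : finType) (h : T -> T') a b x y :
  [set a; b] = [set x; y] -> [set h a; h b] = [set h x; h y].
Proof. by move=> E; rewrite -!imset_set1 -!imsetU E. Qed.

(** A walk in the contraction lifts to [G] once the edge [uv] may be inserted
between its steps.  The lifted walk avoids the edge [ab] if the original one
avoids its image, since two edges with the same ends have the same image. *)
Lemma contract_bridged : bridged G -> bridged G'.
Proof.
move=> br x y xy; have [ne [a [b [ax bY ab]]]] := adj_quo xy.
apply: contra (br _ _ ab); set e := delete_adj a b.
have e_sym : connect_sym e by apply: sym_connect_sym; apply: delete_adj_sym.
have e_uv : connect e u v.
  apply: connect1; rewrite /e /delete_adj uv.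
  apply: contraNneq ne => /(set2_map quo).
  have -> : quo v = quo u.
    by apply: val_inj; rewrite !val_quo /Defs.merge eqxx (negPf uNv).
  rewrite setUid ax bY => E.
  by have := set21 x y; have := set22 x y; rewrite -E !inE => /eqP -> /eqP ->.
move=> H; rewrite -/e.
have : connect e (val x) (val y).
  apply: (connect_hom (f := val)) H => s t /andP[st st_ne].
  have [_ [c [d [cs dt cd]]]] := adj_quo st.
  have e_cd : connect e c d.
    apply: connect1; rewrite /e /delete_adj cd.
    by apply: contra st_ne => /eqP/(set2_map quo); rewrite cs dt ax bY => ->.
  have mc := connect_merge c e_sym e_uv; rewrite e_sym in mc.
  have md := connect_merge d e_sym e_uv.
  by rewrite -cs -dt; apply: connect_trans (connect_trans mc e_cd) md.
rewrite -ax -bY => H'; apply: connect_trans (connect_merge a e_sym e_uv) _.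
by apply: connect_trans H' _; rewrite e_sym; apply: connect_merge.
Qed.

(** Connected sets of the contraction correspond to connected sets of [G] that
contain both or none of [u] and [v]. *)
Let shrink (W : {set G}) : {set G'} := [set x | val x \in W].
Let lift (W : {set G'}) : {set G} := [set x | quo x \in W].

Let mem_lift_uv (W : {set G'}) : (u \in lift W) = (v \in lift W).
Proof.
rewrite !inE; congr (_ \in W); apply: val_inj.
by rewrite !val_quo /Defs.merge eqxx (negPf uNv).
Qed.

Let shrinkK (W : {set G}) : (u \in W) = (v \in W) -> lift (shrink W) = W.
Proof.
by move=> E; apply/setP => x; rewrite !inE val_quo /Defs.merge; case: eqP => [->|].
Qed.

Let liftK (W : {set G'}) : shrink (lift W) = W.
Proof. by apply/setP => x; rewrite !inE quo_val. Qed.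

Lemma card_lift (W : {set G'}) : #|lift W| = (#|W| + (u \in lift W))%N.
Proof.
rewrite (cardsD1 v) -mem_lift_uv addnC; congr (_ + _)%N.
rewrite -(card_imset W val_inj); apply: eq_card => x; rewrite !inE.
apply/andP/imsetP => [[xv xW]|[y yW ->]]; last by rewrite (valP y) quo_val.
by exists (quo x); rewrite // val_quo /Defs.merge (negPf xv).
Qed.

Lemma conn_lift (W : {set G'}) : conn (lift W) = conn W.
Proof.
apply/idP/idP => cW.
  have [x xW] : exists x, x \in lift W by apply/set0Pn; case/andP: cW.
  rewrite inE in xW.
  apply: (@connI _ _ (quo x)) => // y yW.
  have yL : val y \in lift W by rewrite inE quo_val.
  have xL : x \in lift W by rewrite inE.
  rewrite -(quo_val y); apply: connect_hom (conn_connect cW xL yL) => a b.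
  case/and3P=> aW bW ab; rewrite !inE in aW bW.
  have [->|ne] := eqVneq (quo a) (quo b); first exact: connect0.
  by apply: connect1; rewrite /induced aW bW quo_adj.
have [x xW] : exists x, x \in W by apply/set0Pn; case/andP: cW.
have toval z : z \in lift W -> connect (induced (lift W)) z (val (quo z)).
  move=> zW; rewrite val_quo /Defs.merge; case: eqP => [E|_]; last exact: connect0.
  rewrite E in zW *; apply: connect1.
  by rewrite /induced mem_lift_uv zW adj_sym uv.
apply: (@connI _ _ (val x)) => [|y yL]; first by rewrite inE quo_val.
rewrite induced_connect_sym; apply: connect_trans (toval y yL) _.
rewrite induced_connect_sym; rewrite inE in yL.
apply: connect_hom (conn_connect cW xW yL) => s t /and3P[sW tW st].
have [_ [c [d [cs dt cd]]]] := adj_quo st.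
have cL : c \in lift W by rewrite inE cs.
have dL : d \in lift W by rewrite inE dt.
have mc := toval c cL; rewrite induced_connect_sym in mc.
have cdL : connect (induced (lift W)) c d.
  by apply: connect1; rewrite /induced cL dL.
by rewrite -cs -dt; apply: connect_trans (connect_trans mc cdL) (toval d dL).
Qed.

Lemma sum_contract (f : nat -> nat) : bridged G ->
  (\sum_(H in subtrees G') f #|H.1| =
   \sum_(W : {set G} | conn W && ((u \in W) == (v \in W))) f (#|W| - (u \in W)))%N.
Proof.
move=> br; rewrite (sum_subtrees (fun W : {set G'} => f #|W|) (contract_bridged br)).
rewrite [RHS](reindex_onto lift shrink) /=; last first.
  by move=> W /andP[_ /eqP]; apply: shrinkK.
apply: eq_big => W; first by rewrite conn_lift mem_lift_uv liftK !eqxx !andbT.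
by rewrite card_lift addnK.
Qed.

End Contraction.

(** * The mean subtree orders *)

(** Sets containing both ends lose one vertex in the contraction; the lost
vertices are added back so that the equation has no truncated difference. *)
Lemma sum_contract_pairs (G : sgraph) (A B : {set G}) r c : cut A B r c ->
  (\sum_(W1 in rooted A r) \sum_(W2 in rooted B c) (#|W1 :|: W2| - (r \in W1 :|: W2))
   + #|rooted A r| * #|rooted B c| =
   total_order (rooted A r) * #|rooted B c| +
   #|rooted A r| * total_order (rooted B c))%N.
Proof.
move=> cutAB; rewrite -(sum_pairs_1 A B r c) -(sum_pairs_card cutAB) -big_split /=.
apply: eq_bigr => W1; rewrite inE => /and3P[_ _ r1]; rewrite -big_split /=.
apply: eq_bigr => W2 _; have rU : r \in W1 :|: W2 by rewrite inE r1.
by rewrite rU subnK // card_gt0; apply/set0Pn; exists r.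
Qed.

Lemma mean_subtree_order_cut (G : sgraph) (A B : {set G}) r c :
  bridged G -> cut A B r c -> [set: G] = A :|: B ->
  mean_subtree_order G =
  (let a := #|rooted A r|%:R in let a' := (total_order (rooted A r))%:R in
   let p := #|avoiding A r|%:R in let p' := (total_order (avoiding A r))%:R in
   let b := #|rooted B c|%:R in let b' := (total_order (rooted B c))%:R in
   let q := #|avoiding B c|%:R in let q' := (total_order (avoiding B c))%:R in
   (a' + p' + (b' + q') + (a' * b + a * b')) / (a + p + (b + q) + a * b)).
Proof.
move=> br cutAB GAB /=; rewrite /mean_subtree_order -sum1_card.
rewrite (sum_subtrees (fun W : {set G} => #|W|) br).
rewrite (sum_subtrees (fun W : {set G} => 1)%N br).
rewrite !(sum_rooted_avoiding _ r) !sum1_card GAB.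
rewrite -!/(total_order _) (total_rooted_cut cutAB) (total_avoiding_cut cutAB).
rewrite (card_rooted_cut cutAB) (card_avoiding_cut cutAB) !(natrD, natrM).
by congr (_ / _); ring.
Qed.

Lemma mean_subtree_order_contract (G : sgraph) (A B : {set G}) u v :
  bridged G -> cut A B u v -> [set: G] = A :|: B ->
  mean_subtree_order (contract_edge u v) =
  (let a := #|rooted A u|%:R in let a' := (total_order (rooted A u))%:R in
   let p := #|avoiding A u|%:R in let p' := (total_order (avoiding A u))%:R in
   let b := #|rooted B v|%:R in let b' := (total_order (rooted B v))%:R in
   let q := #|avoiding B v|%:R in let q' := (total_order (avoiding B v))%:R in
   (p' + q' + (a' * b + a * b' - a * b)) / (p + q + a * b)).
Proof.
move=> br cutAB GAB /=; rewrite /mean_subtree_order -sum1_card.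
have uv := cut_adj cutAB.
rewrite (sum_contract uv (fun n => n) br) (sum_contract uv (fun=> 1)%N br).
have balE W : conn W && ((u \in W) == (v \in W)) =
    [&& conn W, W \subset A :|: B & (u \in W) == (v \in W)].
  by rewrite -GAB subsetT.
rewrite !(eq_bigl _ _ balE) !(sum_balanced cutAB) sum_pairs_1 !sum1_card.
have avoidA : (\sum_(W in avoiding A u) (#|W| - (u \in W)) =
               total_order (avoiding A u))%N.
  by apply: eq_bigr => W; rewrite inE => /and3P[_ _ /negPf ->]; rewrite subn0.
have avoidB : (\sum_(W in avoiding B v) (#|W| - (u \in W)) =
               total_order (avoiding B v))%N.
  apply: eq_bigr => W; rewrite inE => /and3P[_ sW _].
  have /negPf -> : u \notin W; last by rewrite subn0.
  apply: contraFN (disjointFr (cut_disjoint cutAB) (cut_l cutAB)).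
  exact: (subsetP sW).
rewrite avoidA avoidB.
have /(congr1 (fun n => n%:R : rat)) := sum_contract_pairs cutAB.
rewrite !(natrD, natrM) => /eqP; rewrite -subr_eq => /eqP <-.
by congr (_ / _); ring.
Qed.

Theorem theorem1p1 (T : sgraph) (u v : T) (T_tree : is_tree T)
    (uv_edge : adj u v) (uv_npendant : ~ on_pendant_path u v) :
  mean_subtree_order T - mean_subtree_order (contract_edge u v) > 1 / 3.
Proof.
case: T_tree => _ T_conn /acyclic_bridged br.
have cT : conn [set: T].
  apply: (@connI _ _ u) => // x _.
  by apply: connect_sub (T_conn u x) => a b ab; apply: connect1; rewrite /induced !inE.
have [] := split_cut br cT (in_setT u) (in_setT v) uv_edge.
set A := finset _; set B := finset _ => cutAB cA cB TAB.
have [HA strA] := stats_bounds br cA (cut_l cutAB).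
have [HB _] := stats_bounds br cB (cut_r cutAB).
rewrite (mean_subtree_order_cut br cutAB TAB).
rewrite (mean_subtree_order_contract br cutAB TAB).
apply: (mean_contraction HA HB).
case: strA => // -[s [s_uniq sA s_adj]]; case: uv_npendant; left.
exists s; split=> // [x|i j li lj].
  rewrite sA /A /component !inE; apply: eq_connect => y z.
  by rewrite !inE.
rewrite -s_adj // /= /delete_adj.
have vA : v \notin A by rewrite (disjointFl (cut_disjoint cutAB) (cut_r cutAB)).
(* No edge inside [A] is the deleted one, as [v] lies on the other side. *)
suff -> : [set nth u (u :: s) i; nth u (u :: s) j] != [set u; v] by rewrite andbT.
apply: contra vA => /eqP E; have := set22 u v.
by rewrite -E in_set2 => /orP[] /eqP ->; rewrite -sA mem_nth.
Qed.
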